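(* Assume the quantile-regression setting of the context with $\tau\in(0,1)$, $\beta\in(1,2)$ and $\lambda(x)=|x|^\beta/\beta$. Let $\delta\in(0,1/2)$ and $\rho\ge0$. Assume (C.2), (Q.1) and (Q.2). Put $C_{\delta,n,r}(p):=\log(\delta^{-2})+p\log(1+2nr_n)$, $$\alpha=\frac{1}{n^{1/\beta}}\Big[\frac{C_{\delta,n,r}(p)}{(2^{\beta-1}+1)R_{\lambda\circ\rho_\tau}(\Theta)}\Big]^{1/\beta},$$ and let $$\hat\theta_n\in\arg\min_{\theta\in\Theta}\Big\{\frac{1}{n\alpha}\sum_{i=1}^n\psi_\lambda[\alpha\rho_\tau(Y_i-X_i^\top\theta)]+\rho\|\theta\|_2^2\Big\}.$$ Then, with probability at least $1-2\delta$, $$R_{\rho_\tau}(\hat\theta_n)-R_{\rho_\tau}(\theta^* )\le\frac{2l_\tau\,\mathbb{E}\|X\|_2}{n}+C_{\beta,R_{\lambda\circ\rho_\tau}}\Big[\frac{C_{\delta,n,r}(p)}{n}\Big]^{\frac{\beta-1}{\beta}}+\rho\|\theta^*\|_2^2,$$ where $l_\tau:=\max\{1+\tau,2-\tau\}$ and $$C_{\beta,R_{\lambda\circ\rho_\tau}}:=\frac{2(2^{\beta-1}+1)R_{\lambda\circ\rho_\tau}(\Theta)+\frac{2^{\beta-1}l_\tau^\beta}{\beta}\mathbb{E}\|X\|_2^\beta}{[(2^{\beta-1}+1)R_{\lambda\circ\rho_\tau}(\Theta)]^{\frac{\beta-1}{\beta}}}.$$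
   Context: Setting: $(X_1,Y_1),\dots,(X_n,Y_n)$ are i.i.d. copies of an $\mathbb{R}^p\times\mathbb{R}$-valued random variable $(X,Y)$, with $Y_i=X_i^\top\theta^*+\epsilon_i$, where the errors $\epsilon_i$ are i.i.d. with $P(\epsilon_i<0\mid X_i)=\tau$. The quantile loss is $l(y,x,\theta)=\rho_\tau(y-x^\top\theta)$ with $\rho_\tau(u)=u[\tau-I(u<0)]$. The risk is $R_{\rho_\tau}(\theta)=\mathbb{E}[\rho_\tau(Y-X^\top\theta)]$ and the true parameter is $\theta^*=\arg\min_{\theta\in\Theta}R_{\rho_\tau}(\theta)$. (C.2) $\Theta\subseteq\mathbb{R}^p$ is convex and there is $r_n\in(0,\infty)$ (possibly depending on $n$) with $\|\theta\|_2\le r_n$ for all $\theta\in\Theta$. (Q.1) $\mathbb{E}\|X\|_2^\beta<\infty$. (Q.2) $R_{\lambda\circ\rho_\tau}(\Theta):=\sup_{\theta\in\Theta}\mathbb{E}[\lambda(\rho_\tau(Y-X^\top\theta))]<\infty$ (and it is positive, so that $\alpha$ is defined). Truncation: $\psi_\lambda:\mathbb{R}\to\mathbb{R}$ is a non-decreasing function with $-\log[1-x+\lambda(|x|)]\le\psi_\lambda(x)\le\log[1+x+\lambda(|x|)]$ for all $x\in\mathbb{R}$. Minimizers $\hat\theta_n$ are assumed to exist (any measurable choice). *)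

(* Defs.v *)
From HB Require Import structures.
From mathcomp Require Import all_boot all_order all_algebra.
From mathcomp Require Import all_classical all_reals all_analysis.

Set Implicit Arguments.
Unset Strict Implicit.
Unset Printing Implicit Defensive.

Import Order.TTheory GRing.Theory Num.Theory.
Import numFieldNormedType.Exports.

Local Open Scope classical_set_scope.
Local Open Scope ring_scope.

(* R^p with its Borel sigma-algebra; the library has no measurable structure on
   matrices, so the one generated by the open sets is attached to this alias. *)
Definition Rvec (R : realType) (p : nat) := g_sigma_algebraType (@open 'cV[R]_p).

Definition dotv (R : realType) (p : nat) (x y : 'cV[R]_p) : R :=
  (x^T *m y) 0 0.

(* The library's norm on matrices is the sup norm. *)
Definition norm2 (R : realType) (p : nat) (x : 'cV[R]_p) : R :=
  Num.sqrt (dotv x x).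

Definition is_argmin (disp : Order.disp_t) (V : Type) (U : porderType disp)
    (D : set V) (f : V -> U) (x : V) : Prop :=
  D x /\ forall y, D y -> (f x <= f y)%O.

Section Laws.
Context (d d' : measure_display) (T : measurableType d) (U : measurableType d').
Context (R : realType) (P : probability T R).

Definition mutually_independent (I : finType) (Z : I -> T -> U) : Prop :=
  forall (J : {set I}) (A : I -> set U), (forall i, measurable (A i)) ->
    P (\bigcap_(i in [set i | i \in J]) (Z i @^-1` A i)) =
    (\prod_(i in J) P (Z i @^-1` A i))%E.

Definition same_law (Z Z' : T -> U) : Prop :=
  forall A, measurable A -> P (Z @^-1` A) = P (Z' @^-1` A).

Definition iid (I : finType) (Z : I -> T -> U) : Prop :=
  mutually_independent Z /\ forall i j, same_law (Z i) (Z j).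

Definition iid_copies (I : finType) (Z : I -> T -> U) (Z0 : T -> U) : Prop :=
  mutually_independent Z /\ forall i, same_law (Z i) Z0.

(* g o Z is a version of the conditional probability P(E | Z). *)
Definition is_cond_prob (E : set T) (Z : T -> U) (g : U -> R) : Prop :=
  measurable_fun [set: U] g /\
  forall B, measurable B ->
    P (E `&` Z @^-1` B) = (\int[P]_(w in Z @^-1` B) (g (Z w))%:E)%E.

End Laws.

Section Quantile.
Context (R : realType).

Definition check_loss (tau u : R) : R := u * (tau - (u < 0)%R%:R).

Definition lambda_pow (beta x : R) : R := `|x| `^ beta / beta.

Definition is_truncation (lambda psi : R -> R) : Prop :=
  {homo psi : x y / x <= y} /\
  forall x, - ln (1 - x + lambda `|x|) <= psi x <= ln (1 + x + lambda `|x|).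

Context (p : nat) (d : measure_display) (T : measurableType d).
Context (P : probability T R) (X : T -> 'cV[R]_p) (Y : T -> R).

Definition quantile_risk (tau : R) (theta : 'cV[R]_p) : \bar R :=
  'E_P[fun w => check_loss tau (Y w - dotv (X w) theta)]%E.

Definition sup_lambda_risk (lambda : R -> R) (tau : R) (Theta : set 'cV[R]_p) :
    \bar R :=
  ereal_sup [set 'E_P[fun w => lambda (check_loss tau (Y w - dotv (X w) theta))]%E
            | theta in Theta].

End Quantile.

Section Constants.
Context (R : realType).

Definition C_log (delta : R) (n : nat) (r : R) (p : nat) : R :=
  ln (delta ^- 2) + p%:R * ln (1 + 2 * n%:R * r).

Definition alpha_scale (beta Rl C : R) (n : nat) : R :=
  1 / n%:R `^ (1 / beta) *
  (C / ((2 `^ (beta - 1) + 1) * Rl)) `^ (1 / beta).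

Definition l_lip (tau : R) : R := Num.max (1 + tau) (2 - tau).

Definition C_risk (beta tau Rl EXbeta : R) : R :=
  (2 * (2 `^ (beta - 1) + 1) * Rl
     + 2 `^ (beta - 1) * l_lip tau `^ beta / beta * EXbeta) /
  ((2 `^ (beta - 1) + 1) * Rl) `^ ((beta - 1) / beta).

Definition truncated_objective (n p : nat) (psi : R -> R) (alpha tau rho : R)
    (x : 'I_n -> 'cV[R]_p) (y : 'I_n -> R) (theta : 'cV[R]_p) : R :=
  1 / (n%:R * alpha) *
    (\sum_(i < n) psi (alpha * check_loss tau (y i - dotv (x i) theta)))
  + rho * norm2 theta ^+ 2.

End Constants.

(* Main.v *)
Require Import Defs.
From HB Require Import structures.
From mathcomp Require Import all_boot all_order all_algebra.
From mathcomp Require Import all_classical all_reals all_analysis.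
From mathcomp Require Import measurable_realfun ring lra.

Set Implicit Arguments.
Unset Strict Implicit.
Unset Printing Implicit Defensive.

Import Order.TTheory GRing.Theory Num.Theory.
Import numFieldNormedType.Exports.

Local Open Scope classical_set_scope.
Local Open Scope ring_scope.

(* Since exp(psi x) <= 1 + x + lambda x and exp(- psi x) <= 1 - x + lambda x,
   exponential Markov and independence bound the truncated empirical risk at
   theta_star from above and, by a union bound, the truncated empirical risk at
   every point of a finite 2/n-net of Theta from below.  The lower bound is
   applied to the loss at the net point minus (l_tau/n)|X|, which is dominated by
   the loss at any theta within 2/n, so that the monotonicity of psi transfers it
   to theta_hat.  Moving the population risk from the net point to theta_hat costs
   another l_tau E|X|/n, and alpha balances the moment and deviation terms.  The
   net has at most (1 + 2nr)^p points, which needs no volume on R^p: a lattice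
   count gives K^p for any integer K > 1 + nr, and K <= 1 + 2nr is possible once
   nr >= 1, while for nr < 1 one point suffices. *)

(** * Euclidean norm and inner product on column vectors *)

Section EuclideanNorm.
Context (R : realType) (p : nat).
Implicit Types x y : 'cV[R]_p.

Lemma dotvE x y : dotv x y = \sum_j x j 0 * y j 0.
Proof. by rewrite /dotv mxE; apply: eq_bigr => j _; rewrite mxE. Qed.

Lemma dotvC x y : dotv x y = dotv y x.
Proof. by rewrite !dotvE; apply: eq_bigr => j _; rewrite mulrC. Qed.

Lemma dotvDr x y z : dotv x (y + z) = dotv x y + dotv x z.
Proof. by rewrite /dotv mulmxDr mxE. Qed.

Lemma dotvZr a x y : dotv x (a *: y) = a * dotv x y.
Proof. by rewrite /dotv -scalemxAr mxE. Qed.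

Lemma dotvNr x y : dotv x (- y) = - dotv x y.
Proof. by rewrite /dotv mulmxN mxE. Qed.

Lemma dotvv_ge0 x : 0 <= dotv x x.
Proof. by rewrite dotvE; apply: sumr_ge0 => j _; rewrite -expr2 sqr_ge0. Qed.

Lemma norm2_ge0 x : 0 <= norm2 x.
Proof. exact: sqrtr_ge0. Qed.

Lemma sqr_norm2 x : norm2 x ^+ 2 = dotv x x.
Proof. by rewrite sqr_sqrtr// dotvv_ge0. Qed.

Lemma norm2N x : norm2 (- x) = norm2 x.
Proof. by rewrite /norm2 dotvNr dotvC dotvNr opprK. Qed.

Lemma norm2B x y : norm2 (x - y) = norm2 (y - x).
Proof. by rewrite -norm2N opprB. Qed.

Lemma norm2Z a x : norm2 (a *: x) = `|a| * norm2 x.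
Proof.
by rewrite /norm2 dotvZr dotvC dotvZr mulrA -expr2 sqrtrM ?sqr_ge0// sqrtr_sqr.
Qed.

Lemma coord_le_norm2 x j : `|x j 0| <= norm2 x.
Proof.
rewrite -sqrtr_sqr ler_wsqrtr// dotvE (bigD1 j)//= -expr2 lerDl.
by apply: sumr_ge0 => i _; rewrite -expr2 sqr_ge0.
Qed.

(** The crude factor [p] in place of its square root costs nothing: wherever this is applied, the
    coordinate bound already carries a factor [1 / p.+1]. *)
Lemma norm2_le_coord x c : 0 <= c -> (forall j, `|x j 0| <= c) ->
  norm2 x <= p%:R * c.
Proof.
move=> c0 xc; rewrite -ler_sqr ?nnegrE ?norm2_ge0 ?mulr_ge0//.
rewrite sqr_norm2 dotvE (@le_trans _ _ (\sum_(j < p) c ^+ 2))//.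
  apply: ler_sum => j _; rewrite -expr2 -real_normK ?num_real//.
  by rewrite ler_sqr ?nnegrE.
rewrite sumr_const card_ord -[_ *+ p]mulr_natl exprMn ler_wpM2r ?sqr_ge0//.
by rewrite -natrX ler_nat -[X in (X <= _)%N]expn1; case: p => // q; rewrite leq_pexp2l.
Qed.

Lemma norm2_eq0 x : norm2 x = 0 -> x = 0.
Proof.
move=> x0; apply/matrixP => j k; rewrite ord1 mxE.
by apply/eqP; rewrite -normr_eq0 eq_le normr_ge0 andbT -x0 coord_le_norm2.
Qed.

Lemma norm2_0 : norm2 (0 : 'cV[R]_p) = 0.
Proof. by rewrite -(scale0r (0 : 'cV[R]_p)) norm2Z normr0 mul0r. Qed.

Lemma dotv_le x y : dotv x y <= norm2 x * norm2 y.
Proof.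
have [x0|x0] := eqVneq (norm2 x) 0.
  by rewrite x0 (norm2_eq0 x0) mul0r dotvE big1// => j _; rewrite mxE mul0r.
have [y0|y0] := eqVneq (norm2 y) 0.
  by rewrite y0 (norm2_eq0 y0) mulr0 dotvE big1// => j _; rewrite mxE mulr0.
have xy : 0 < norm2 x * norm2 y by rewrite mulr_gt0// lt_neqAle eq_sym ?x0 ?y0 norm2_ge0.
(* Cauchy-Schwarz by expanding the square of |y| x - |x| y, which equals 2ab (ab - c) with a, b, c
   as named below. *)
have := dotvv_ge0 (norm2 y *: x - norm2 x *: y).
rewrite dotvDr dotvNr !dotvZr ![dotv (_ - _) _]dotvC !dotvDr !dotvNr !dotvZr.
rewrite (dotvC y x) -!sqr_norm2.
move: xy; set a := norm2 x; set b := norm2 y; set c := dotv x y => xy H.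
have H2 : 0 <= (2 * (a * b)) * (a * b - c) by lra.
have ab2 : 0 < 2 * (a * b) by rewrite mulr_gt0.
by rewrite -subr_ge0 -(pmulr_rge0 _ ab2).
Qed.

Lemma normr_dotv_le x y : `|dotv x y| <= norm2 x * norm2 y.
Proof. by rewrite ler_norml dotv_le andbT lerNl -dotvNr -(norm2N y) dotv_le. Qed.

Lemma norm2_triangle x y : norm2 (x + y) <= norm2 x + norm2 y.
Proof.
rewrite -ler_sqr ?nnegrE ?norm2_ge0 ?addr_ge0 ?norm2_ge0//.
rewrite sqr_norm2 dotvDr ![dotv (_ + _) _]dotvC !dotvDr sqrrD -!sqr_norm2.
have := dotv_le x y; rewrite (dotvC y x); lra.
Qed.

End EuclideanNorm.

(** * Packing numbers of a Euclidean ball by lattice counting *)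

Section Packing.
Context (R : realType) (p : nat).

(* Volume comparison by counting points of a fine lattice: dividing a lattice
   point of the ball of radius r + e by K and translating it to x i lands in the
   ball of radius e around x i, and the quotients have fibres of size K ^ p. *)
Lemma packing_bound (N K : nat) (r e : R) (x : 'I_N -> 'cV[R]_p) :
  0 <= r -> 0 < e -> (forall i, norm2 (x i) <= r) ->
  (forall i j, i != j -> 2 * e < norm2 (x i - x j)) ->
  r + e < K%:R * e -> (N <= K ^ p)%N.
Proof.
move=> r0 e0 xr xsep Ke.
have K1 : (1 < K)%N.
  by rewrite -(ltr_nat R) -(ltr_pM2r e0) mul1r (le_lt_trans _ Ke)// lerDr.
have K0 : 0 < K%:R :> R by rewrite ltr0n (ltn_trans _ K1).
case: K K1 K0 Ke => // K K1 K0 Ke.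
pose rho := r + e.
have rho0 : 0 <= rho by rewrite addr_ge0// ltW.
have rhoK : rho / K.+1%:R < e by rewrite ltr_pdivrMr// mulrC.
(* The mesh [h] is so fine that a rounding error of [2 * h] per coordinate stays below the slack
   [e - rho / K.+1]. *)
pose h : R := (e - rho / K.+1%:R) / (2 * p.+1%:R).
have h0 : 0 < h by rewrite divr_gt0 ?subr_gt0// mulr_gt0.
have hp : rho / K.+1%:R + p%:R * (2 * h) < e.
  have -> : p%:R * (2 * h) = (p%:R / p.+1%:R) * (e - rho / K.+1%:R).
    by rewrite /h; field; rewrite !nat1r !pnatr_eq0.
  by rewrite -ltrBrDl gtr_pMl ?subr_gt0// ltr_pdivrMr// mul1r ltr_nat.
(* Signed lattice coordinates are coded by naturals below [2 * m], with [m] standing for the origin.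
   The bound [2 * rho / h < m] keeps the translations [t] nonnegative and the quotient points in
   range. *)
pose m := (Num.bound (2 * rho / h)).+1.
have hm : 2 * rho / h < m%:R.
  have h2 : 0 <= 2 * rho / h by apply: divr_ge0; [exact: mulr_ge0|exact: ltW].
  apply: (lt_trans (archi_boundP h2)); rewrite ltr_nat; exact: ltnSn.
pose M := (m + m)%N.
pose pt (a : {ffun 'I_p -> 'I_M}) : 'cV[R]_p :=
  \col_j (h * ((a j)%:R - m%:R)).
pose V := [set a | norm2 (pt a) <= rho]%SET.
have M0 : (m < M)%N by rewrite /M -[X in (X < _)%N]addn0 ltn_add2l.
have V0 : (0 < #|V|)%N.
  apply/card_gt0P; exists [ffun=> Ordinal M0]; rewrite inE.
  rewrite (_ : pt _ = 0) ?norm2_0 ?addr_ge0 ?(ltW e0)//.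
  by apply/matrixP => j k; rewrite !mxE ffunE/= subrr mulr0.
(* The offset [m - m / K.+1] is forced by the coding: (a - m)/K + x/h is recoded as a/K + t. Since
   [t] is nonnegative, [s] is its floor. *)
pose t i j : R := m%:R - m%:R / K.+1%:R + x i j 0 / h.
pose s i j := Num.truncn (t i j).
have xh i j : `|x i j 0 / h| <= rho / h.
  rewrite normf_div (gtr0_norm h0) ler_pM2r ?invr_gt0//.
  by rewrite (le_trans (coord_le_norm2 _ _))// (le_trans (xr i))// lerDl ltW.
have K2 : 2 <= K.+1%:R :> R by rewrite ler_nat.
have t0 i j : 0 <= t i j.
  have mK : m%:R / K.+1%:R <= m%:R / 2 :> R.
    by rewrite ler_wpM2l// lef_pV2// posrE.
  have := xh i j; rewrite ler_norml => /andP[+ _].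
  move: hm mK; rewrite /t -mulrA.
  set u := rho / h; set v := x i j 0 / h; set w := m%:R / K.+1%:R.
  lra.
have sP i j : (s i j)%:R <= t i j < (s i j)%:R + 1.
  by rewrite natr1; exact: truncn_itv.
pose q i (a : {ffun 'I_p -> 'I_M}) j := (a j %/ K.+1 + s i j)%N.
pose y i a : 'cV[R]_p := \col_j (h * ((q i a j)%:R - m%:R)).
(* Scaling [pt a] by 1/K contributes at most [rho / K.+1]. The quotient and [s] are both rounded
   down, each by at most one unit, whence [2 * h] per coordinate. *)
have yx i a : norm2 (pt a) <= rho -> norm2 (y i a - x i) < e.
  move=> aV; rewrite (le_lt_trans _ hp)//.
  have -> : y i a - x i = K.+1%:R^-1 *: pt a + (y i a - x i - K.+1%:R^-1 *: pt a).
    by rewrite [RHS]addrC subrK.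
  rewrite (le_trans (norm2_triangle _ _))// lerD//.
    by rewrite norm2Z ger0_norm ?invr_ge0// mulrC ler_wpM2r ?invr_ge0.
  apply: norm2_le_coord => [|j]; first by rewrite mulr_ge0// ltW.
  rewrite !mxE /q natrD.
  have -> : h * ((a j %/ K.+1)%:R + (s i j)%:R - m%:R) - x i j 0 -
      K.+1%:R^-1 * (h * ((a j)%:R - m%:R)) =
      h * (((a j %/ K.+1)%:R - (a j)%:R / K.+1%:R) + ((s i j)%:R - t i j)).
    rewrite /t; field; rewrite nat1r pnatr_eq0 /= gt_eqF//.
  rewrite normrM gtr0_norm// mulrC ler_pM2r//.
  have := sP i j.
  have : (a j)%:R / K.+1%:R - 1 <= ((a j %/ K.+1)%:R : R) <= (a j)%:R / K.+1%:R.
    apply/andP; split; last first.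
      by rewrite ler_pdivlMr// -natrM ler_nat leq_trunc_div.
    rewrite lerBlDr natr1 ler_pdivrMr// -natrM ler_nat ltnW//.
    by rewrite ltn_ceil.
  set u := (a j)%:R / _; set v := (_ %/ _)%:R; set w := (s i j)%:R.
  by rewrite ler_norml => /andP[? ?] /andP[? ?]; apply/andP; split; lra.
have yM i a : norm2 (pt a) <= rho -> forall j, (q i a j < M)%N.
  move=> aV j.
  have yr : norm2 (y i a) <= rho.
    rewrite -[y i a](subrK (x i)) (le_trans (norm2_triangle _ _))//.
    by rewrite /rho addrC lerD// ltW// yx.
  have := le_trans (coord_le_norm2 (y i a) j) yr.
  rewrite mxE normrM gtr0_norm// mulrC -ler_pdivlMr// ler_norml => /andP[_].
  rewrite lerBlDr => qm; rewrite -(ltr_nat R) (le_lt_trans qm)// natrD ltrD2r.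
  rewrite (le_lt_trans _ hm)// -mulrA ler_peMl//; last by rewrite ler1n.
  by rewrite divr_ge0 ?addr_ge0// ltW.
(* The remainders modulo [K.+1] are recorded next to the quotient point. By [yM] the default of
   [insubd] is never taken when [a] is in [V]. *)
pose f (ia : 'I_N * {ffun 'I_p -> 'I_M}) :
    {ffun 'I_p -> 'I_M} * {ffun 'I_p -> 'I_K.+1} :=
  ([ffun j => insubd (Ordinal M0) (q ia.1 ia.2 j)],
   [ffun j => inord (ia.2 j %% K.+1)]).
have ptf i a : a \in V -> pt (f (i, a)).1 = y i a.
  rewrite inE => aV; apply/matrixP => j k; rewrite !mxE ffunE.
  by rewrite val_insubd/= yM.
(* A quotient point shared by two indices would lie within [e] of two centres that are more than
   [2 * e] apart. So it determines [i], and Euclidean division then recovers [a]. *)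
have f_inj : {in finset.setX [set: 'I_N]%SET V &, injective f}.
  move=> [i a] [i' a']; rewrite !inE/= => aV aV' ff.
  have yy : y i a = y i' a' by rewrite -!ptf ?inE// ff.
  have ii : i = i'.
    apply/eqP/negPn/negP => /xsep; rewrite ltNge => /negP; apply.
    have -> : x i - x i' = (y i' a' - x i') - (y i a - x i).
      by rewrite yy opprB [RHS]addrC addrA subrK.
    rewrite (le_trans (norm2_triangle _ _))// norm2N.
    have := yx i a aV; have := yx i' a' aV'; lra.
  subst i'; congr (_, _); apply/ffunP => j; apply: val_inj.
  move: ff => [/ffunP/(_ j) + /ffunP/(_ j)].
  rewrite !ffunE => /(congr1 val); rewrite !val_insubd !yM//=.
  move=> /addIn fq /(congr1 val); rewrite /= !inordK ?ltn_pmod// => fr.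
  by rewrite (divn_eq (a j) K.+1) fq fr -divn_eq.
have fV : (f @: finset.setX [set: 'I_N]%SET V
    \subset finset.setX V [set: {ffun 'I_p -> 'I_K.+1}])%SET.
  apply/fintype.subsetP => ia' /imsetP[[i a]]; rewrite !inE/= => aV ->.
  rewrite ptf ?inE// andbT -[y i a](subrK (x i)).
  rewrite (le_trans (norm2_triangle _ _))// /rho addrC lerD//.
  exact/ltW/yx.
(* Injectivity gives N |V| <= |V| K^p, and [V] contains the origin, so |V| cancels. *)
have := subset_leq_card fV; rewrite card_in_imset// !cardsX !cardsT card_ord.
by rewrite card_ffun !card_ord mulnC leq_pmul2l.
Qed.
End Packing.

(** * Exponential bounds for the truncation function *)

Section TruncationBounds.
Context (R : realType).

(** Young's inequality for x * 1 with exponents b and b/(b-1); the leftover constant (b-1)/b is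
    strictly below 1. This keeps the arguments of both logarithms positive, so that they can be
    exponentiated. *)
Lemma powR_div_gt (b x : R) : 1 < b -> 0 <= x -> x < 1 + x `^ b / b.
Proof.
move=> b1 x0; have b0 : 0 < b by rewrite (lt_trans _ b1).
have := @conjugate_powR R x 1 b (b / (b - 1)) x0 ler01 b0.
rewrite powR1 mulr1 divr_gt0 ?subr_gt0// => /(_ isT).
have -> : b^-1 + (b / (b - 1))^-1 = 1.
  by field; rewrite subr_eq0 (gt_eqF b1) (gt_eqF b0).
move=> /(_ erefl) /le_lt_trans; apply; rewrite addrC ltrD2r.
by rewrite invf_div mul1r ltr_pdivrMr// mul1r ltrBlDr ltrDl.
Qed.

Lemma lambda_pow_norm (b x : R) : lambda_pow b `|x| = lambda_pow b x.
Proof. by rewrite /lambda_pow normr_id. Qed.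

Lemma lambda_pow_ge0 (b x : R) : 0 <= b -> 0 <= lambda_pow b x.
Proof. by move=> b0; rewrite divr_ge0// powR_ge0. Qed.

Lemma normr_lt_lambda_pow (b x : R) : 1 < b -> `|x| < 1 + lambda_pow b x.
Proof. by move=> b1; exact: powR_div_gt. Qed.

Lemma expR_truncation_le (b : R) (psi : R -> R) x : 1 < b ->
  is_truncation (lambda_pow b) psi -> expR (psi x) <= 1 + x + lambda_pow b x.
Proof.
move=> b1 [_ /(_ x)/andP[_]]; rewrite lambda_pow_norm => H.
rewrite -[X in _ <= X]lnK ?ler_expR// posrE.
by have := normr_lt_lambda_pow x b1; have := ler_norm (- x); rewrite normrN; lra.
Qed.

Lemma expR_truncationN_le (b : R) (psi : R -> R) x : 1 < b ->
  is_truncation (lambda_pow b) psi -> expR (- psi x) <= 1 - x + lambda_pow b x.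
Proof.
move=> b1 [_ /(_ x)/andP[+ _]]; rewrite lambda_pow_norm lerNl => H.
rewrite -[X in _ <= X]lnK ?ler_expR// posrE.
by have := normr_lt_lambda_pow x b1; have := ler_norm x; lra.
Qed.

Lemma lambda_powM (b a x : R) : 0 <= a ->
  lambda_pow b (a * x) = a `^ b * lambda_pow b x.
Proof. by move=> a0; rewrite /lambda_pow normrM ger0_norm// powRM// mulrA. Qed.

(** Midpoint convexity of the power function, applied to |x| and |y|. *)
Lemma lambda_powB_le (b x y : R) : 1 < b ->
  lambda_pow b (x - y) <= 2 `^ (b - 1) * (lambda_pow b x + lambda_pow b y).
Proof.
move=> b1; have b0 : 0 < b by rewrite (lt_trans _ b1).
rewrite /lambda_pow -mulrDl mulrA ler_pM2r ?invr_gt0//.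
have xy : `|x - y| <= `|x| + `|y| by rewrite -(normrN y) ler_normD.
apply: (@le_trans _ _ ((`|x| + `|y|) `^ b)).
  by apply: ge0_ler_powR; rewrite ?nnegrE ?addr_ge0// ltW.
have h0 : (0 : R) <= 2^-1 by [].
have h1 : (2^-1 : R) <= 1 by rewrite invf_le1// ler1n.
have H : (2^-1 * `|x| + (1 - 2^-1) * `|y|) `^ b <=
    2^-1 * `|x| `^ b + (1 - 2^-1) * `|y| `^ b.
  by apply: (convex_powR (ltW b1) (Itv01 h0 h1));
    rewrite inE/= in_itv/= andbT normr_ge0.
have half : (1 - 2^-1 : R) = 2^-1 by lra.
rewrite half -!mulrDr powRM ?addr_ge0// -!powR_inv1// -powRrM mulN1r in H.
have b2 : (2 : R) `^ b = 2 `^ (b - 1) * 2 by rewrite mulrC mulr_powRB1.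
move: H; rewrite powRN powR_inv1// ler_pdivrMl ?powR_gt0// b2.
by rewrite mulrA mulfK.
Qed.
End TruncationBounds.

(** * Positivity and Lipschitz continuity of the check loss *)

Section CheckLoss.
Context (R : realType) (tau : R).
Hypothesis tau01 : 0 < tau < 1.

Lemma check_loss_ge0 u : 0 <= check_loss tau u.
Proof.
case/andP: tau01 => t0 t1; rewrite /check_loss; case: ltP => /= u0.
  by rewrite nmulr_rge0// subr_le0 ltW.
by rewrite subr0 mulr_ge0// ltW.
Qed.

Lemma l_lip_gt0 : 0 < l_lip tau.
Proof. by case/andP: tau01 => t0 t1; rewrite lt_max addr_gt0. Qed.

(* The sharp constant max(tau, 1 - tau) equals l_lip tau - 1 and is at most half
   of l_lip tau; this is what allows covers of radius 2/n instead of 1/n. *)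
Lemma check_loss_le u v :
  check_loss tau u <= check_loss tau v + l_lip tau / 2 * `|u - v|.
Proof.
case/andP: tau01 => t0 t1; set l := l_lip tau / 2.
have lt : tau <= l.
  by rewrite ler_pdivlMr// le_max; apply/orP; left; lra.
have lt' : 1 - tau <= l.
  by rewrite ler_pdivlMr// le_max; apply/orP; right; lra.
have l0 : 0 < l by rewrite (lt_le_trans t0).
have lr (a b c : R) : 0 <= a -> b <= c -> b * a <= c * a.
  by move=> a0 bc; rewrite ler_wpM2r.
rewrite /check_loss; case: (ltP u 0) => u0; case: (ltP v 0) => v0 /=;
  rewrite ?mulr1n ?subr0.
- have := lr `|u - v| (1 - tau) l (normr_ge0 _) lt'.
  have : (1 - tau) * (v - u) <= (1 - tau) * `|u - v|.
    by rewrite ler_wpM2l ?subr_ge0 ?(ltW t1)// -normrN opprB ler_norm.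
  lra.
- rewrite ltr0_norm; last by lra.
  have := lr (- u) (1 - tau) l; have := lr v 0 l; have := lr v 0 tau; lra.
- rewrite ger0_norm; last by lra.
  have := lr u tau l u0 lt; have := lr (- v) 0 l; have := lr (- v) 0 (1 - tau); lra.
- have := lr `|u - v| tau l (normr_ge0 _) lt.
  have : tau * (u - v) <= tau * `|u - v| by rewrite ler_wpM2l ?(ltW t0)// ler_norm.
  lra.
Qed.
End CheckLoss.

(** * Borel measurability *)

Section VectorMeasurability.
Context (R : realType) (p : nat).

(** Preimages of the rays above [a] are open, and these rays generate the Borel sets of the line.
    The topology is that of the sup norm, so [norm2_le_coord] converts the radius. *)
Lemma lipschitz_measurable (f : 'cV[R]_p -> R) (c : R) :
  (forall x y, f x - f y <= c * norm2 (x - y)) ->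
  measurable_fun [set: Rvec R p] (f : Rvec R p -> R).
Proof.
move=> fL; apply: (measurability (@RGenOInfty.G R)) => [|/= _ [_] [a] -> <-].
  exact: RGenOInfty.measurableE.
rewrite setTI; apply: sub_sigma_algebra; rewrite openE => x /=.
rewrite ?in_itv/= ?andbT => ax.
have c0 : 0 < `|c| + 1 by rewrite ltr_wpDl.
(* With this radius, (|c| + 1) p e is p/(p+1) times [f x - a], hence strictly smaller; [|c| + 1]
   replaces [c], whose sign is unknown. *)
pose e := (f x - a) / ((`|c| + 1) * p.+1%:R).
have e0 : 0 < e by rewrite divr_gt0 ?subr_gt0// mulr_gt0.
apply/nbhs_ballP; exists e => //= y xy.
have xye : norm2 (x - y) <= p%:R * e.
  apply: norm2_le_coord => [|j]; first exact: ltW.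
  by have [_ /(_ j 0)] := xy; rewrite /ball/= !mxE => /ltW.
have H : c * norm2 (x - y) < f x - a.
  apply: (@le_lt_trans _ _ ((`|c| + 1) * (p%:R * e))).
    apply: le_trans (_ : `|c| * (p%:R * e) <= _).
      apply: (le_trans (_ : _ <= `|c| * norm2 (x - y))).
        by rewrite ler_wpM2r ?norm2_ge0// ler_norm.
      by rewrite ler_wpM2l.
    by rewrite ler_wpM2r ?lerDl// mulr_ge0// ltW.
  rewrite mulrCA (_ : _ * e = (f x - a) / p.+1%:R); last first.
    by rewrite /e; field; rewrite nat1r pnatr_eq0/= ?andbT lt0r_neq0.
  by rewrite mulrCA gtr_pMr ?subr_gt0// ltr_pdivrMr// mul1r ltr_nat.
by have := le_lt_trans (fL x y) H; rewrite ltrD2l ltrN2 /= in_itv/= andbT.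
Qed.

Lemma measurable_dotvl (y : 'cV[R]_p) :
  measurable_fun [set: Rvec R p] (fun x : Rvec R p => dotv x y).
Proof.
apply: (@lipschitz_measurable (fun x => dotv x y) (norm2 y)) => x z.
rewrite ![dotv _ y]dotvC -dotvNr -dotvDr.
exact: dotv_le.
Qed.

Lemma measurable_norm2 : measurable_fun [set: Rvec R p] (@norm2 R p).
Proof.
apply: (@lipschitz_measurable (@norm2 R p) 1) => x z.
by rewrite mul1r lerBlDr -{1}(subrK z x) norm2_triangle.
Qed.
End VectorMeasurability.

Section Measurability.
Context (R : realType).

Lemma measurable_check_loss (tau : R) : measurable_fun [set: R] (check_loss tau).
Proof.
apply: measurable_funM => //; apply: measurable_funB => //.
apply: (@measurableT_comp _ _ _ _ _ _ (fun b : bool => b%:R : R)) => //.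
by apply: measurable_fun_ltr.
Qed.

Lemma measurable_lambda_pow (b : R) : measurable_fun [set: R] (lambda_pow b).
Proof.
apply: measurable_funM => //.
by apply: (measurableT_comp (measurable_powR b)); exact: normr_measurable.
Qed.
End Measurability.

(** * Product rule for expectations under mutual independence *)

Section Independence.
Local Open Scope ereal_scope.
Context d d' (T : measurableType d) (U : measurableType d') (R : realType).
Variable P : probability T R.

Import HBNNSimple.

Lemma integral_weighted_nnsfun (G : T -> \bar R) (Z : T -> U)
    (h : {nnsfun U >-> R}) :
  measurable_fun setT G -> (forall w, 0 <= G w) -> measurable_fun setT Z ->
  \int[P]_w (G w * (h (Z w))%:E) =
  \sum_(y \in range h) (y%:E * \int[P]_w (G w * (\1_(h @^-1` [set y]) (Z w))%:E)).
Proof.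
move=> mG G0 mZ.
have mI y : measurable_fun setT (fun w => (\1_(h @^-1` [set y]) (Z w))%:E : \bar R).
  by apply/measurable_EFinP; apply: measurableT_comp => //; exact: measurable_indic.
transitivity (\int[P]_w (\sum_(y \in range h)
    (y%:E * (G w * (\1_(h @^-1` [set y]) (Z w))%:E)))).
  apply: eq_integral => w _; rewrite fimfunE -fsumEFin// ge0_mule_fsumr//; last first.
    by move=> y; rewrite nnfun_muleindic_ge0.
  by apply: eq_fsbigr => y _; rewrite EFinM muleCA.
have h0 y w : 0 <= y%:E * (G w * (\1_(h @^-1` [set y]) (Z w))%:E).
  by rewrite muleCA mule_ge0// -EFinM nnfun_muleindic_ge0.
rewrite ge0_integral_fsum//; last first.
  by move=> y; apply: measurable_funeM; exact: emeasurable_funM.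
apply: eq_fsbigr => y; rewrite inE => -[u _ <-].
rewrite ge0_integralZl//.
- exact: emeasurable_funM.
- by move=> w _; rewrite mule_ge0// lee_fin.
- by rewrite lee_fin.
Qed.

(** The standard extension from indicators to simple functions to monotone limits. In the
    application [G] is the product of the factors at the other indices and [c] the product of their
    expectations. *)
Lemma weighted_integral_comp (G : T -> R) (c : R) (Z : T -> U) (f : U -> R) :
  measurable_fun setT G -> (forall w, (0 <= G w)%R) -> measurable_fun setT Z ->
  (0 <= c)%R ->
  (forall A, measurable A ->
    \int[P]_w ((G w)%:E * (\1_A (Z w))%:E) = c%:E * P (Z @^-1` A)) ->
  measurable_fun setT f -> (forall u, (0 <= f u)%R) ->
  \int[P]_w ((G w)%:E * (f (Z w))%:E) = c%:E * \int[P]_w (f (Z w))%:E.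
Proof.
move=> mG G0 mZ c0 GA mf f0.
have mf' : measurable_fun setT (EFin \o f) by exact/measurable_EFinP.
pose h := nnsfun_approx measurableT mf'.
have hcvg u : (h n u)%:E @[n --> \oo] --> (f u)%:E.
  by apply: (@cvg_nnsfun_approx _ _ _ _ measurableT (EFin \o f) mf') => // x _;
    rewrite lee_fin.
have hnd u m n : (m <= n)%N -> (h m u <= h n u)%R.
  by move=> mn; exact/lefP/nd_nnsfun_approx.
have mh n : measurable_fun setT (fun w => (h n (Z w))%:E).
  by apply/measurable_EFinP; exact: measurableT_comp.
(* The weight is general because the limit is taken twice, with weight [G] and with weight 1. *)
have lim1 (K : T -> R) : measurable_fun setT K -> (forall w, (0 <= K w)%R) ->
    (fun n => \int[P]_w ((K w)%:E * (h n (Z w))%:E)) @ \oo -->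
    \int[P]_w ((K w)%:E * (f (Z w))%:E).
  move=> mK K0.
  have mKh n : measurable_fun setT (fun w => (K w)%:E * (h n (Z w))%:E).
    by apply: emeasurable_funM => //; exact/measurable_EFinP.
  have K0h n w : setT w -> 0 <= (K w)%:E * (h n (Z w))%:E.
    by move=> _; rewrite mule_ge0// lee_fin.
  have Kh w : setT w -> nondecreasing_seq (fun n => (K w)%:E * (h n (Z w))%:E).
    by move=> _ m n mn; rewrite lee_wpmul2l// lee_fin// hnd.
  have := @cvg_monotone_convergence _ _ _ P _ measurableT _ mKh K0h Kh.
  congr (_ --> _); apply: eq_integral => w _; apply/cvg_lim => //.
  by apply: cvgeZl => //; exact: hcvg.
have simple n : \int[P]_w ((G w)%:E * (h n (Z w))%:E) =
    c%:E * \int[P]_w (h n (Z w))%:E.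
  rewrite (integral_weighted_nnsfun (h n) (G := EFin \o G))//;
    last exact/measurable_EFinP.
  rewrite [X in _ = _ * X](_ : _ = \int[P]_w (cst 1 w * (h n (Z w))%:E)); last first.
    by apply: eq_integral => w _; rewrite mul1e.
  rewrite (integral_weighted_nnsfun (h n) (G := cst 1))//.
  rewrite ge0_mule_fsumr//; last first.
    (* A negative [y] is not a value of [h n], so its level set is empty. *)
    move=> y; case: (leP 0%R y) => [y0|y0].
      by rewrite mule_ge0// ?lee_fin// integral_ge0// => w _; rewrite mule_ge0 ?lee_fin.
    rewrite integral0_eq ?mule0// => w _; rewrite /cst mul1e preimage_nnfun0//.
    by rewrite indic0.
  apply: eq_fsbigr => y _; rewrite muleCA; congr (_ * _).
  rewrite GA//; congr (_ * _).
  under eq_integral do rewrite mul1e.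
  rewrite -[RHS]/(\int[P]_w (\1_(Z @^-1` (h n @^-1` [set y])) w)%:E).
  by rewrite integral_indic ?setIT// -[X in measurable X]setTI; exact: mZ.
have lim1f := lim1 (cst 1%R) (measurable_cst _) (fun=> ler01).
have E2 (g : T -> R) : \int[P]_w (g w)%:E = \int[P]_w ((cst 1%R w)%:E * (g w)%:E).
  by apply: eq_integral => w _; rewrite mul1e.
have limG := lim1 G mG G0; rewrite (funext simple) in limG.
have limc : (fun n => c%:E * \int[P]_w (h n (Z w))%:E) @ \oo -->
    c%:E * \int[P]_w (f (Z w))%:E.
  by apply: cvgeZl => //; under eq_fun do rewrite E2; rewrite E2.
exact: (cvg_unique _ limG limc).
Qed.

(* Indicators, for which the product rule is the definition of independence, are
   traded for the functions f i one index at a time. *)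
Lemma independent_prod_integral (n : nat) (Z : 'I_n -> T -> U)
    (f : 'I_n -> U -> R) :
  mutually_independent P Z -> (forall i, measurable_fun setT (Z i)) ->
  (forall i, measurable_fun setT (f i)) -> (forall i u, (0 <= f i u)%R) ->
  (forall i, \int[P]_w (f i (Z i w))%:E < +oo) ->
  \int[P]_w (\prod_(i < n) f i (Z i w))%:E = \prod_(i < n) \int[P]_w (f i (Z i w))%:E.
Proof.
move=> indZ mZ mf f0 foo.
(* Hybrid factors: [f i] for indices below [k], the indicator of [A i] from [k] on. The claim is
   proved for all families [A] at once, because the step alters [A] at index [k]. *)
pose g (A : 'I_n -> set U) (k : nat) (i : 'I_n) : U -> R :=
  if ((i : 'I_n) < k)%N then f i else \1_(A i).
pose e (A : 'I_n -> set U) k i := fine (\int[P]_w (g A k i (Z i w))%:E).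
have mg A k i : (forall i, measurable (A i)) -> measurable_fun setT (g A k i).
  by rewrite /g; case: ifP => // _ mA; exact: measurable_indic.
have g0 A k i u : (0 <= g A k i u)%R by rewrite /g; case: ifP.
have eE A k i : (forall i, measurable (A i)) ->
    (e A k i)%:E = \int[P]_w (g A k i (Z i w))%:E.
  move=> mA; rewrite fineK// ge0_fin_numE; last first.
    by apply: integral_ge0 => w _; rewrite lee_fin.
  rewrite /g; case: ifP => _ //.
  rewrite -[X in X < _]/(\int[P]_w (\1_(Z i @^-1` A i) w)%:E).
  have mZA : measurable (Z i @^-1` A i) by rewrite -[X in measurable X]setTI; exact: mZ.
  by rewrite integral_indic// setIT (le_lt_trans (probability_le1 _ _))// ltry.
suff H k : (k <= n)%N -> forall A : 'I_n -> set U, (forall i, measurable (A i)) ->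
    \int[P]_w (\prod_(i < n) g A k i (Z i w))%:E = (\prod_(i < n) e A k i)%:E.
  pose A0 := fun _ : 'I_n => @setT U.
  have gn i : g A0 n i = f i by rewrite /g ltn_ord.
  transitivity (\int[P]_w (\prod_(i < n) g A0 n i (Z i w))%:E).
    by apply: eq_integral => w _; congr EFin; apply: eq_bigr => i _; rewrite /g ltn_ord.
  rewrite (H n (leqnn n) A0 (fun=> measurableT)) -prodEFin.
  by apply: eq_bigr => i _; rewrite (eE A0 n i (fun=> measurableT)) gn.
elim: k => [_ A mA|k IH kn A mA].
  have mZA i : measurable (Z i @^-1` A i).
    by rewrite -[X in measurable X]setTI; exact: mZ.
  pose I := \bigcap_(i in [set i | i \in [set: 'I_n]%SET]) (Z i @^-1` A i).
  have mI : measurable I by apply: fin_bigcap_measurable => //; exact: finite_finset.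
  transitivity (\int[P]_w (\1_I w)%:E).
    apply: eq_integral => w _; rewrite /g/=; congr EFin.
    rewrite indicE; case: (pselect (forall i, A i (Z i w))) => Aw.
      rewrite mem_set; last by move=> i _; exact: Aw.
      by rewrite big1// => i _; rewrite indicE mem_set.
    rewrite memNset; last by move=> Aw'; apply: Aw => i; apply: Aw'; rewrite /= inE.
    move/existsNP: Aw => [i Ai].
    by rewrite (bigD1 i)//= indicE memNset// mul0r.
  rewrite integral_indic// setIT.
  transitivity (\prod_(i in [set: 'I_n]%SET) P (Z i @^-1` A i)); first exact: indZ.
  rewrite -prodEFin; apply: eq_big => [i|i _]; first by rewrite inE.
  rewrite eE// /g/= -[RHS]/(\int[P]_w (\1_(Z i @^-1` A i) w)%:E).
  by rewrite integral_indic// setIT.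
pose k' := Ordinal kn.
have gE B i : i != k' -> g B k.+1 i = g B k i.
  by move=> ik; rewrite /g ltnS leq_eqVlt -[(i == k :> nat)]/(i == k') (negbTE ik).
have gk B : g B k.+1 k' = f k' by rewrite /g/= ltnSn.
have gk0 B : g B k k' = \1_(B k') by rewrite /g/= ltnn.
pose G w := (\prod_(i < n | i != k') g A k i (Z i w))%R.
pose c := (\prod_(i < n | i != k') e A k i)%R.
transitivity (\int[P]_w ((G w)%:E * (f k' (Z k' w))%:E)).
  apply: eq_integral => w _; rewrite -EFinM; congr EFin.
  rewrite (bigD1 k')//= mulrC gk; congr (_ * _)%R.
  by apply: eq_bigr => i ik; rewrite gE.
rewrite (@weighted_integral_comp G c (Z k') (f k'))//.
- rewrite [in RHS](bigD1 k')//= mulrC EFinM; congr (_ * _).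
    by congr EFin; apply: eq_bigr => i ik; rewrite /e gE.
  by rewrite eE// gk.
- rewrite /G; under eq_fun do rewrite -big_filter; apply: measurable_prod => i _.
  by apply: measurableT_comp => //; exact: mg.
- by move=> w; apply: prodr_ge0.
- by apply: prodr_ge0 => i _; rewrite fine_ge0// integral_ge0// => w _; rewrite lee_fin.
(* The hypothesis on indicators is the induction hypothesis for the family with [B] placed at index
   [k']. *)
- move=> B mB; pose A' i := if i == k' then B else A i.
  have mA' i : measurable (A' i) by rewrite /A'; case: ifP.
  have A'E i : i != k' -> g A' k i = g A k i by rewrite /g /A' => /negbTE ->.
  have := IH (ltnW kn) A' mA'.
  rewrite (bigD1 k')//= mulrC EFinM eE// gk0 /A' eqxx.
  rewrite -[X in _ = _ * X]/(\int[P]_w (\1_(Z k' @^-1` B) w)%:E).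
  rewrite integral_indic ?setIT//; last by rewrite -[X in measurable X]setTI; exact: mZ.
  rewrite -/A' (_ : \prod_(i < n | i != k') e A' k i = c)%R; last first.
    by apply: eq_bigr => i ik; rewrite /e A'E.
  move=> <-; apply: eq_integral => w _; rewrite -EFinM; congr EFin.
  rewrite [in RHS](bigD1 k')//= mulrC gk0 /A' eqxx -/A'; congr (_ * _)%R.
  by apply: eq_bigr => i ik; rewrite A'E.
Qed.
End Independence.

(** * Exponential tail bound for i.i.d. sums *)

Section Tail.
Local Open Scope ereal_scope.
Context d d' (T : measurableType d) (U : measurableType d') (R : realType).
Variable P : probability T R.

Lemma same_law_integral (Z Z' : T -> U) (f : U -> \bar R) :
  same_law P Z Z' -> measurable_fun setT Z -> measurable_fun setT Z' ->
  measurable_fun setT f -> (forall u, 0 <= f u) ->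
  \int[P]_w f (Z w) = \int[P]_w f (Z' w).
Proof.
move=> ZZ' mZ mZ' mf f0.
rewrite -[LHS]/(\int[P]_(w in Z @^-1` setT) (f \o Z) w).
rewrite -[RHS]/(\int[P]_(w in Z' @^-1` setT) (f \o Z') w).
rewrite -!ge0_integral_pushforward//.
by apply: eq_measure_integral => A mA _; exact: ZZ'.
Qed.

(** Chernoff at parameter 1: the exponential moment of the sum is at most (1 + c)^n <= exp(n c), and
    the extra [ln delta^-1] in the threshold turns this into [delta]. *)
Lemma iid_chernoff (n : nat) (Z : 'I_n -> T -> U) (Z0 : T -> U) (h : U -> R)
    (c delta : R) :
  (0 < delta)%R -> iid_copies P Z Z0 ->
  (forall i, measurable_fun setT (Z i)) -> measurable_fun setT Z0 ->
  measurable_fun setT h ->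
  \int[P]_w (expR (h (Z0 w)))%:E <= (1 + c)%:E ->
  let B := [set w | (n%:R * c + ln delta^-1 <= \sum_(i < n) h (Z i w))%R] in
  measurable B /\ P B <= delta%:E.
Proof.
move=> d0 [indZ lawZ] mZ mZ0 mh hc B.
have meh : measurable_fun setT (expR \o h) by exact: measurableT_comp.
have eh0 u : 0 <= (expR (h u))%:E by rewrite lee_fin expR_ge0.
have I0 : 0 <= \int[P]_w (expR (h (Z0 w)))%:E by exact: integral_ge0.
have [v vE] : exists v, \int[P]_w (expR (h (Z0 w)))%:E = v%:E.
  exists (fine (\int[P]_w (expR (h (Z0 w)))%:E)).
  by rewrite fineK// ge0_fin_numE// (le_lt_trans hc)// ltry.
rewrite vE !lee_fin in hc I0.
have hci i : \int[P]_w (expR (h (Z i w)))%:E = v%:E.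
  rewrite -vE.
  apply: (@same_law_integral _ _ (fun u => (expR (h u))%:E) (lawZ i) (mZ i) mZ0) => //.
  exact/measurable_EFinP.
pose S w := (\sum_(i < n) h (Z i w))%R.
have mS : measurable_fun setT S.
  by apply: measurable_sum => i; exact: measurableT_comp.
pose X : {RV P >-> R} := HB.pack S (isMeasurableFun.Build _ _ _ _ S mS).
split.
  have := mS measurableT _ (@measurable_itv R `[(n%:R * c + ln delta^-1)%R, +oo[).
  by rewrite setTI; congr measurable; apply/seteqP; split=> w /=; rewrite in_itv/= andbT.
apply: (le_trans (@chernoff _ _ _ P X 1 (n%:R * c + ln delta^-1) ltr01)).
rewrite /mmt_gen_fun unlock.
have -> : \int[P]_w ((expR \o 1 \o* X) w)%:E = (v ^+ n)%:E.
  rewrite -[X in (_ ^+ X)%:E]card_ord -prodr_const -prodEFin.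
  transitivity (\prod_(i < n) \int[P]_w (expR (h (Z i w)))%:E); last exact: eq_bigr.
  have foo i : \int[P]_w ((expR \o h) (Z i w))%:E < +oo by rewrite [X in X < _]hci ltry.
  rewrite -(independent_prod_integral indZ mZ (fun=> meh) (fun _ _ => expR_ge0 _) foo).
  by apply: eq_integral => w _; rewrite /= mulr1 expR_sum.
rewrite mul1r -EFinM lee_fin expRN expRD lnK ?posrE ?invr_gt0// invfM invrK.
apply: (@le_trans _ _ (expR c ^+ n * ((expR (n%:R * c))^-1 * delta))%R).
  apply: ler_wpM2r; first by rewrite mulr_ge0 ?invr_ge0 ?expR_ge0 ?ltW.
  by rewrite lerXn2r ?nnegrE ?expR_ge0// (le_trans hc)// expR_ge1Dx.
by rewrite -expRM_natl mulrA divff ?mul1r// gt_eqF// expR_gt0.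
Qed.
End Tail.

(** * Finite nets of the parameter set *)

Section Net.
Context (R : realType) (p : nat).

Definition separated (Theta : set 'cV[R]_p) (e : R) (N : nat) : Prop :=
  exists x : 'I_N -> 'cV[R]_p, (forall i, Theta (x i)) /\
    forall i j, i != j -> e < norm2 (x i - x j).

Lemma separated_card (Theta : set 'cV[R]_p) (r : R) (n N : nat) :
  0 < r -> (0 < n)%N -> (forall theta, Theta theta -> norm2 theta <= r) ->
  separated Theta (2 / n%:R) N -> N%:R <= (1 + 2 * n%:R * r) ^+ p.
Proof.
move=> r0 n0 Tr [x [xT xsep]].
have nR : 0 < n%:R :> R by rewrite ltr0n.
have nr0 : 0 < n%:R * r by rewrite mulr_gt0.
(* If nr < 1, any two points of [Theta] are less than 2/n apart, so a separated family has at most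
   one point. *)
have [nr|nr] := ltP (n%:R * r) 1.
  suff N1 : (N <= 1)%N.
    rewrite (@le_trans _ _ 1)//; first by rewrite (ler_nat _ N 1).
    by apply: exprn_ege1; lra.
  rewrite leqNgt; apply/negP => N1.
  have := xsep (Ordinal (ltnW N1)) (Ordinal N1) isT.
  apply/negP; rewrite -leNgt (le_trans (norm2_triangle _ _))// norm2N.
  have := Tr _ (xT (Ordinal (ltnW N1))); have := Tr _ (xT (Ordinal N1)).
  have : r < 1 / n%:R by rewrite ltr_pdivlMr// mulrC.
  lra.
(* This [K] exceeds 1 + nr, as the packing bound with e = 1/n requires, and is at most 2 + nr <= 1 +
   2nr. *)
pose K := (Num.truncn (1 + n%:R * r)).+1.
have /andP[K1 K2] : (Num.truncn (1 + n%:R * r))%:R <= 1 + n%:R * r < K%:R.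
  by apply: truncn_itv; lra.
have KR : K%:R <= 1 + 2 * n%:R * r by rewrite /K -natr1; lra.
apply: (@le_trans _ _ (K%:R ^+ p)); last by rewrite lerXn2r// nnegrE; lra.
rewrite -natrX ler_nat.
apply: (@packing_bound R p N K r (1 / n%:R) x (ltW r0)).
- by rewrite divr_gt0.
- by move=> i; exact: Tr.
- by move=> i j ij; rewrite mul1r; exact: xsep.
- by rewrite mulrA mulr1 ltr_pdivlMr// mulrDl divfK ?gt_eqF// addrC mulrC.
Qed.

(** A separated family of maximal size is a net: a point far from all its members could be added to
    it. Its points lie in [Theta], where the moment bound is available. *)
Lemma exists_net (Theta : set 'cV[R]_p) (r : R) (n : nat) :
  0 < r -> (0 < n)%N -> (forall theta, Theta theta -> norm2 theta <= r) ->
  exists N (x : 'I_N -> 'cV[R]_p),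
    [/\ N%:R <= (1 + 2 * n%:R * r) ^+ p, forall i, Theta (x i) &
        forall theta, Theta theta -> exists i, norm2 (theta - x i) <= 2 / n%:R].
Proof.
move=> r0 n0 Tr; set M := (1 + 2 * n%:R * r) ^+ p.
have M0 : 0 <= M by rewrite exprn_ge0// addr_ge0// mulr_ge0// ltW.
have bd N : `[< separated Theta (2 / n%:R) N >] -> (N <= Num.truncn M)%N.
  by move=> /asboolP/(separated_card r0 n0 Tr) NM; rewrite truncn_ge_nat.
have s0 : exists N, `[< separated Theta (2 / n%:R) N >].
  by exists 0%N; apply/asboolP; exists (fun=> 0); split=> [[]|[]].
case: (ex_maxnP s0 bd) => N /asboolP sN maxN.
have [x [xT xsep]] := sN; exists N, x; split => //.
  exact: (separated_card r0 n0 Tr).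
move=> theta Ttheta; apply: contrapT => /forallNP far.
suff /asboolP/maxN : separated Theta (2 / n%:R) N.+1 by rewrite ltnn.
exists (fun i => if unlift ord0 i is Some j then x j else theta); split=> [i|i j].
  by case: unliftP.
case: unliftP => [i' ->|->]; case: unliftP => [j' ->|->] //.
- by rewrite (inj_eq lift_inj); exact: xsep.
- by move=> _; rewrite norm2B ltNge; apply/negP; exact: far.
- by move=> _; rewrite ltNge; apply/negP; exact: far.
Qed.
End Net.

(** * Union bound over a finite index type *)

Section UnionBound.
Context d (T : measurableType d) (R : realType) (P : probability T R).

Lemma union_bound (N : nat) (B : 'I_N -> set T) (a : R) :
  (forall i, measurable (B i) /\ (P (B i) <= a%:E)%E) ->
  measurable (\bigcup_i B i) /\ (P (\bigcup_i B i) <= (N%:R * a)%:E)%E.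
Proof.
move=> BP; pose A k := if insub k is Some i then B i else set0.
have AB (i : 'I_N) : A i = B i by rewrite /A valK.
have mA k : measurable (A k).
  by rewrite /A; case: insubP => // i _ _; exact: (BP i).1.
have BA : \bigcup_i B i = \big[setU/set0]_(i < N) A i.
  rewrite -bigcup_mkord; apply/seteqP; split=> [w [i _ Bw]|w [k /= kN]].
    by exists i => /=; rewrite ?AB.
  by rewrite -[k]/(val (Ordinal kN)) AB => Bw; exists (Ordinal kN).
rewrite BA; split; first exact: bigsetU_measurable.
apply: (le_trans (Boole_inequality P _)) => //.
rewrite (@le_trans _ _ (\sum_(i < N) a%:E)%E)//.
  by apply: lee_sum => i _; rewrite AB; exact: (BP i).2.
by rewrite sumEFin sumr_const card_ord mulr_natl.
Qed.
End UnionBound.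

(** * The choice of the scale alpha *)

Section Scale.
Context (R : realType).

(** Everything follows from alpha^b = C/(nK): the deviation term C/(n alpha) then equals the moment
    term alpha^(b-1) K, and both are of order (C/n)^((b-1)/b). *)
Lemma alpha_scale_facts (b Rl C : R) (n : nat) :
  1 < b -> 0 < Rl -> 0 < C -> (0 < n)%N ->
  let alpha := alpha_scale b Rl C n in
  let K := (2 `^ (b - 1) + 1) * Rl in
  [/\ 0 < alpha, alpha `^ b = alpha * alpha `^ (b - 1),
      C / (n%:R * alpha) = alpha `^ (b - 1) * K &
      alpha `^ (b - 1) = (C / n%:R) `^ ((b - 1) / b) / K `^ ((b - 1) / b)].
Proof.
move=> b1 Rl0 C0 n0 alpha K.
have b0 : 0 < b by rewrite (lt_trans _ b1).
have nR : 0 < n%:R :> R by rewrite ltr0n.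
have K0 : 0 < K by rewrite mulr_gt0// addr_gt0// powR_gt0.
have CnK : 0 < C / n%:R / K by rewrite !divr_gt0.
have invp (x s : R) : 0 < x -> (x^-1) `^ s = (x `^ s)^-1.
  by move=> x0; rewrite -powR_inv1 ?ltW// -powRrM mulN1r powRN.
have aE : alpha = (C / n%:R / K) `^ b^-1.
  rewrite /alpha /alpha_scale !div1r -/K -invp// -powRM ?invr_ge0 ?divr_ge0 ?ltW//.
  by congr (_ `^ _); field; rewrite !gt_eqF.
have a0 : 0 < alpha by rewrite aE powR_gt0.
have aB : alpha `^ b = alpha * alpha `^ (b - 1) by rewrite mulr_powRB1// ltW.
split => //.
  have : alpha `^ b = C / n%:R / K by rewrite aE -powRrM mulVf ?gt_eqF// powRr1// ltW.
  rewrite aB => E.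
  have -> : alpha `^ (b - 1) = (C / n%:R / K) / alpha.
    by rewrite -E mulrAC divff ?mul1r// gt_eqF.
  by field; rewrite !gt_eqF.
rewrite aE -powRrM (mulrC b^-1) powRM ?divr_ge0 ?invr_ge0 ?ltW//.
by rewrite invp.
Qed.
End Scale.

(** * Integrability and linear bounds on integrals *)

Section Integrals.
Context d (T : measurableType d) (R : realType) (P : probability T R).
Implicit Types A B F : T -> R.

Lemma Rintegral_lin (a b : R) A B :
  P.-integrable [set: T] (EFin \o A) -> P.-integrable [set: T] (EFin \o B) ->
  P.-integrable [set: T] (EFin \o (fun w => a * A w + b * B w)) /\
  \int[P]_w (a * A w + b * B w) = a * \int[P]_w A w + b * \int[P]_w B w.
Proof.
move=> iA iB.
have iaA : P.-integrable [set: T] (EFin \o (fun w => a * A w)).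
  by have := integrableZl measurableT a iA.
have ibB : P.-integrable [set: T] (EFin \o (fun w => b * B w)).
  by have := integrableZl measurableT b iB.
split; first by have := integrableD measurableT iaA ibB.
by rewrite RintegralD// !RintegralZl.
Qed.

(** The form 1 + a is the one [iid_chernoff] expects of an exponential moment. [A] may change sign,
    but 1 + A dominates [F] and is therefore nonnegative. *)
Lemma integral_le_lin F A (a : R) : measurable_fun [set: T] F ->
  (forall w, 0 <= F w) -> P.-integrable [set: T] (EFin \o A) ->
  (forall w, F w <= 1 + A w) -> \int[P]_w A w <= a ->
  (\int[P]_w (F w)%:E <= (1 + a)%:E)%E.
Proof.
move=> mF F0 iA FA Aa.
have mA : measurable_fun [set: T] A by apply/measurable_EFinP; exact: measurable_int iA.
apply: (@le_trans _ _ (\int[P]_w (1 + A w)%:E)%E).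
  apply: ge0_le_integral => //.
  - by move=> w _; rewrite lee_fin.
  - exact/measurable_EFinP.
  - by apply/measurable_EFinP; exact: measurable_funD.
  - by move=> w _; rewrite lee_fin.
have i1 : P.-integrable [set: T] (EFin \o cst (1 : R)).
  by apply: finite_measure_integrable_cst.
rewrite [X in (X <= _)%E](@integralD_EFin _ _ _ P _ _ (cst 1) A)//.
have -> : (\int[P]_w (cst (1 : R) w)%:E = 1)%E.
  by rewrite (@integral_cst _ T R P _ measurableT 1%:E)/= probability_setT mule1.
rewrite -[X in (_ + X <= _)%E]fineK.
  by rewrite -EFinD lee_fin lerD2l.
exact: integrable_fin_num.
Qed.

Lemma integrable_ge0 F : measurable_fun [set: T] F -> (forall w, 0 <= F w) ->
  (\int[P]_w (F w)%:E < +oo)%E -> P.-integrable [set: T] (EFin \o F).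
Proof.
move=> mF F0 Foo; apply/integrableP; split; first exact/measurable_EFinP.
by under eq_integral do rewrite /= ger0_norm//.
Qed.

Lemma integrable_lambda_pow (b : R) F : 1 < b -> measurable_fun [set: T] F ->
  (\int[P]_w (lambda_pow b (F w))%:E < +oo)%E ->
  P.-integrable [set: T] (EFin \o F).
Proof.
move=> b1 mF Foo.
have mL : measurable_fun [set: T] (fun w => lambda_pow b (F w)).
  exact: measurableT_comp (measurable_lambda_pow b) mF.
have L0 w : 0 <= lambda_pow b (F w) by rewrite lambda_pow_ge0// (le_trans _ (ltW b1)).
have iL := integrable_ge0 mL L0 Foo.
apply/integrableP; split; first exact/measurable_EFinP.
apply: le_lt_trans (@integral_le_lin (fun w => `|F w|) _ _ _ _ iL _ (lexx _)) _.
- exact: measurableT_comp.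
- by [].
- by move=> w; exact/ltW/normr_lt_lambda_pow.
- by rewrite ltry.
Qed.
End Integrals.

(** * Risk and exponential moments of the truncated loss *)

Section QuantileRisk.
Context (R : realType) (p : nat) (d : measure_display) (T : measurableType d).
Context (P : probability T R) (Z : T -> Rvec R p * R) (tau : R).
Hypothesis mZ : measurable_fun [set: T] Z.
Hypothesis tau01 : 0 < tau < 1.

Definition loss (theta : 'cV[R]_p) (z : Rvec R p * R) : R :=
  check_loss tau (z.2 - dotv z.1 theta).

Lemma loss_ge0 theta z : 0 <= loss theta z.
Proof. exact: check_loss_ge0. Qed.

Lemma measurable_loss theta : measurable_fun [set: Rvec R p * R] (loss theta).
Proof.
apply: (measurableT_comp (measurable_check_loss tau)).
apply: measurable_funB; first exact: measurable_snd.
exact: (measurableT_comp (measurable_dotvl theta) measurable_fst).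
Qed.

Lemma measurable_norm2_fst :
  measurable_fun [set: Rvec R p * R] (fun z : Rvec R p * R => norm2 z.1).
Proof. by apply: (measurableT_comp (@measurable_norm2 R p)); exact: measurable_fst. Qed.

Lemma loss_le theta theta' z : loss theta z <=
  loss theta' z + l_lip tau / 2 * (norm2 z.1 * norm2 (theta - theta')).
Proof.
apply: (le_trans (check_loss_le tau01 _ (z.2 - dotv z.1 theta'))).
rewrite lerD2l ler_wpM2l ?divr_ge0 ?(ltW (l_lip_gt0 tau01))//.
rewrite opprB addrC subrKA distrC -dotvNr -dotvDr.
exact: normr_dotv_le.
Qed.

Lemma loss_comp_le theta theta' w : loss theta (Z w) <=
  loss theta' (Z w) + l_lip tau / 2 * norm2 (theta - theta') * norm2 (Z w).1.
Proof. by rewrite -mulrA [_ * norm2 (Z w).1]mulrC; exact: loss_le. Qed.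

(** Real-valued so that it enters linear arithmetic; it agrees with [quantile_risk] where the loss
    is integrable, in particular on [Theta]. *)
Definition rrisk theta := \int[P]_w loss theta (Z w).

Hypothesis iX : P.-integrable [set: T] (EFin \o (fun w => norm2 (Z w).1)).

Lemma integrable_loss theta theta' :
  P.-integrable [set: T] (EFin \o (fun w => loss theta' (Z w))) ->
  P.-integrable [set: T] (EFin \o (fun w => loss theta (Z w))).
Proof.
move=> il; apply: integrable_ge0.
- exact: (measurableT_comp (measurable_loss theta) mZ).
- by move=> w; exact: loss_ge0.
have [iL _] := Rintegral_lin 1 (l_lip tau / 2 * norm2 (theta - theta')) il iX.
apply: le_lt_trans (integral_le_lin _ _ iL _ (lexx _)) _; last exact: ltry.
- exact: (measurableT_comp (measurable_loss theta) mZ).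
- by move=> w; exact: loss_ge0.
by move=> w; have := loss_comp_le theta theta' w; lra.
Qed.

Lemma rrisk_le theta theta' :
  P.-integrable [set: T] (EFin \o (fun w => loss theta' (Z w))) ->
  rrisk theta <=
    rrisk theta' + l_lip tau / 2 * norm2 (theta - theta') * \int[P]_w norm2 (Z w).1.
Proof.
move=> il'; have il := integrable_loss theta il'.
have [iL rL] := Rintegral_lin 1 (l_lip tau / 2 * norm2 (theta - theta')) il' iX.
rewrite -[X in X + _]mul1r -rL; apply: le_Rintegral => // w _.
by have := loss_comp_le theta theta' w; lra.
Qed.

(** The risk is Lipschitz in theta with constant l_tau/2 times E|X|. Measurability is needed because
    the risk is evaluated at the random point [theta_hat]. *)
Lemma measurable_rrisk theta' :
  P.-integrable [set: T] (EFin \o (fun w => loss theta' (Z w))) ->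
  measurable_fun [set: Rvec R p] rrisk.
Proof.
move=> il'.
apply: (@lipschitz_measurable _ _ rrisk (l_lip tau / 2 * \int[P]_w norm2 (Z w).1)).
move=> x y; rewrite lerBlDl mulrAC; apply: rrisk_le.
exact: integrable_loss il'.
Qed.

Variables (b : R) (psi : R -> R).
Hypothesis b1 : 1 < b.
Hypothesis psi_trunc : is_truncation (lambda_pow b) psi.
Hypothesis iXb : P.-integrable [set: T] (EFin \o (fun w => norm2 (Z w).1 `^ b)).

Lemma measurable_truncation : measurable_fun [set: R] psi.
Proof. by apply: nondecreasing_measurable => //; case: psi_trunc. Qed.

Lemma integrable_lambda_loss theta Rl :
  (\int[P]_w (lambda_pow b (loss theta (Z w)))%:E <= Rl%:E)%E ->
  [/\ P.-integrable [set: T] (EFin \o (fun w => lambda_pow b (loss theta (Z w)))),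
      P.-integrable [set: T] (EFin \o (fun w => loss theta (Z w))) &
      \int[P]_w lambda_pow b (loss theta (Z w)) <= Rl].
Proof.
move=> LRl; have Loo := le_lt_trans LRl (ltry Rl).
have ml := measurableT_comp (measurable_loss theta) mZ.
have iL : P.-integrable [set: T] (EFin \o (fun w => lambda_pow b (loss theta (Z w)))).
  apply: integrable_ge0 => //.
    exact: measurableT_comp (measurable_lambda_pow b) ml.
  by move=> w; rewrite lambda_pow_ge0// (le_trans _ (ltW b1)).
split=> //; first exact: integrable_lambda_pow b1 ml Loo.
by rewrite -lee_fin fineK//; exact: integrable_fin_num.
Qed.

Lemma exp_truncated_loss_le theta (a Rl : R) : 0 < a ->
  (\int[P]_w (lambda_pow b (loss theta (Z w)))%:E <= Rl%:E)%E ->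
  (\int[P]_w (expR (psi (a * loss theta (Z w))))%:E <=
   (1 + (a * rrisk theta + a `^ b * Rl))%:E)%E.
Proof.
move=> a0 /integrable_lambda_loss [iL il LRl].
have [iA rA] := Rintegral_lin a (a `^ b) il iL.
apply: (integral_le_lin _ _ iA).
- apply: measurableT_comp => //; apply: (measurableT_comp measurable_truncation).
  by apply: measurable_funM => //; exact: (measurableT_comp (measurable_loss theta) mZ).
- by move=> w; exact: expR_ge0.
- move=> w; rewrite addrA -lambda_powM ?(ltW a0)//.
  exact: expR_truncation_le.
- by rewrite rA lerD2l ler_wpM2l// powR_ge0.
Qed.

(** The subtracted multiple of |X| absorbs the distance from a net point to the estimator.
    [lambda_powB_le] separates it from the loss, at the price of the factor 2^(b-1). *)
Lemma exp_truncated_lossN_le theta (a s Rl : R) : 0 < a -> 0 <= s ->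
  (\int[P]_w (lambda_pow b (loss theta (Z w)))%:E <= Rl%:E)%E ->
  (\int[P]_w (expR (- psi (a * (loss theta (Z w) - s * norm2 (Z w).1))))%:E <=
   (1 + (a * s * \int[P]_w norm2 (Z w).1 - a * rrisk theta +
    a `^ b * 2 `^ (b - 1) *
      (Rl + s `^ b / b * \int[P]_w (norm2 (Z w).1 `^ b))))%:E)%E.
Proof.
move=> a0 s0 /integrable_lambda_loss [iL il LRl].
have b0 : 0 < b by rewrite (lt_trans _ b1).
have [iA1 rA1] := Rintegral_lin (a * s) (- a) iX il.
have [iA2 rA2] := Rintegral_lin 1 (s `^ b / b) iL iXb.
have [iA rA] := Rintegral_lin 1 (a `^ b * 2 `^ (b - 1)) iA1 iA2.
apply: (integral_le_lin _ _ iA).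
- apply: measurableT_comp => //; apply: measurable_funN.
  apply: (measurableT_comp measurable_truncation); apply: measurable_funM => //.
  apply: measurable_funB; first exact: (measurableT_comp (measurable_loss theta) mZ).
  apply: measurable_funM => //.
  exact: (measurableT_comp measurable_norm2_fst mZ).
- by move=> w; exact: expR_ge0.
- move=> w; apply: (le_trans (expR_truncationN_le _ b1 psi_trunc)).
  rewrite lambda_powM ?(ltW a0)//.
  have := lambda_powB_le (loss theta (Z w)) (s * norm2 (Z w).1) b1.
  rewrite [lambda_pow b (s * _)]lambda_powM// [lambda_pow b (norm2 _)]/lambda_pow.
  rewrite (ger0_norm (norm2_ge0 _)) => /(ler_wpM2l (powR_ge0 a b)).
  set u := lambda_pow b _; set v := norm2 _ `^ b; set c := a `^ b.
  set k := b^-1; set t := 2 `^ _; set e := s `^ b; lra.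
- rewrite rA rA1 rA2 !mul1r mulNr lerD2l ler_wpM2l ?mulr_ge0 ?powR_ge0//.
  by rewrite lerD2r.
Qed.

End QuantileRisk.

(** * The excess risk bound *)

Theorem corollary10 (R : realType) (n p : nat)
    (d : measure_display) (T : measurableType d) (P : probability T R)
    (X : {RV P >-> Rvec R p}) (Y : {RV P >-> R})
    (Xs : 'I_n -> {RV P >-> Rvec R p}) (Ys : 'I_n -> {RV P >-> R})
    (eps : 'I_n -> {RV P >-> R})
    (Theta : set 'cV[R]_p) (theta_star : 'cV[R]_p)
    (tau beta delta rho r : R) (psi : R -> R)
    (theta_hat : {RV P >-> Rvec R p})
    (n_gt0 : (0 < n)%N)
    (tau_gt0 : 0 < tau) (tau_lt1 : tau < 1)
    (beta_gt1 : 1 < beta) (beta_lt2 : beta < 2)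
    (delta_gt0 : 0 < delta) (delta_lt : delta < 1 / 2)
    (rho_ge0 : 0 <= rho)
    (sample_iid : iid_copies P (fun i w => (Xs i w, Ys i w))
                               (fun w => (X w, Y w)))
    (model : forall i w, Ys i w = dotv (Xs i w) theta_star + eps i w)
    (eps_iid : iid P eps)
    (eps_quantile : forall i,
        is_cond_prob P [set w | eps i w < 0] (Xs i) (cst tau))
    (theta_star_min : is_argmin Theta (quantile_risk P X Y tau) theta_star)
    (Theta_convex : convex_set (Theta : set (convex_lmodType 'cV[R]_p)))
    (r_gt0 : 0 < r)
    (Theta_bounded : forall theta, Theta theta -> norm2 theta <= r)
    (Q1 : ('E_P[fun w => (norm2 (X w) `^ beta)%R] < +oo)%E)
    (Q2 : (0 < sup_lambda_risk P X Y (lambda_pow beta) tau Theta < +oo)%E)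
    (psi_trunc : is_truncation (lambda_pow beta) psi) :
  let Rl := fine (sup_lambda_risk P X Y (lambda_pow beta) tau Theta) in
  let EX := fine ('E_P[fun w => norm2 (X w)])%E in
  let EXbeta := fine ('E_P[fun w => (norm2 (X w) `^ beta)%R])%E in
  let C := C_log delta n r p in
  let alpha := alpha_scale beta Rl C n in
  (forall w, is_argmin Theta
     (truncated_objective psi alpha tau rho (fun i => Xs i w) (fun i => Ys i w))
     (theta_hat w)) ->
  (P [set w | (quantile_risk P X Y tau (theta_hat w)
               - quantile_risk P X Y tau theta_star <=
        (2 * l_lip tau * EX / n%:R
         + C_risk beta tau Rl EXbeta * (C / n%:R) `^ ((beta - 1) / beta)
         + rho * norm2 theta_star ^+ 2)%:E)%E]
   >= (1 - 2 * delta)%:E)%E.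
Proof.
move=> Rl EX EXbeta C alpha theta_hat_min.
have tau01 : 0 < tau < 1 by rewrite tau_gt0 tau_lt1.
have b0 : 0 < beta by rewrite (lt_trans _ beta_gt1).
have l0 := l_lip_gt0 tau01.
have nR : 0 < n%:R :> R by rewrite ltr0n.
pose Z w : Rvec R p * R := (X w, Y w).
pose Zs i w : Rvec R p * R := (Xs i w, Ys i w).
have mZ : measurable_fun [set: T] Z by exact: measurable_fun_pair.
have mZs i : measurable_fun [set: T] (Zs i) by exact: measurable_fun_pair.
have [Q20 Q2oo] := andP Q2.
have sRl : sup_lambda_risk P X Y (lambda_pow beta) tau Theta = Rl%:E.
  by rewrite /Rl fineK// ge0_fin_numE// ltW.
have Rl0 : 0 < Rl by rewrite -lte_fin -sRl.
have LRl th : Theta th ->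
    (\int[P]_w (lambda_pow beta (loss tau th (Z w)))%:E <= Rl%:E)%E.
  by move=> Tth; rewrite -sRl; apply: ereal_sup_ubound; exists th => //; rewrite unlock.
have mN : measurable_fun [set: T] (fun w => norm2 (Z w).1).
  exact: measurableT_comp (@measurable_norm2_fst R p) mZ.
have iXb : P.-integrable [set: T] (EFin \o (fun w => norm2 (Z w).1 `^ beta)).
  apply: integrable_ge0.
  - exact: measurableT_comp (measurable_powR beta) mN.
  - by move=> w; exact: powR_ge0.
  - by move: Q1; rewrite unlock.
have iX : P.-integrable [set: T] (EFin \o (fun w => norm2 (Z w).1)).
  apply: (integrable_lambda_pow beta_gt1 mN).
  have := integral_fune_lt_pinfty measurableT (Rintegral_lin beta^-1 0 iXb iXb).1.
  congr (_ < _)%E; apply: eq_integral => w _; congr EFin.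
  by rewrite mul0r addr0 mulrC /lambda_pow ger0_norm ?norm2_ge0.
have il th : Theta th -> P.-integrable [set: T] (EFin \o (fun w => loss tau th (Z w))).
  by move=> /LRl /(integrable_lambda_loss mZ beta_gt1)[].
have Tstar := theta_star_min.1.
pose risk := rrisk P Z tau.
have riskE th : Theta th -> quantile_risk P X Y tau th = (risk th)%:E.
  move=> /il ith; rewrite /quantile_risk unlock -[LHS]fineK//.
  exact: integrable_fin_num ith.
have EXE : EX = \int[P]_w norm2 (Z w).1 by rewrite /EX unlock.
have EXbE : EXbeta = \int[P]_w (norm2 (Z w).1 `^ beta) by rewrite /EXbeta unlock.
have EX0 : 0 <= EX by rewrite EXE; apply: Rintegral_ge0 => w _; exact: norm2_ge0.
have EXb0 : 0 <= EXbeta by rewrite EXbE; apply: Rintegral_ge0 => w _; exact: powR_ge0.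
pose M := (1 + 2 * n%:R * r) ^+ p.
have M1 : 1 <= M by rewrite exprn_ege1// lerDl mulr_ge0// ltW.
have M0 : 0 < M by rewrite (lt_le_trans _ M1).
(* The two copies of ln(1/delta) in [C] serve the two deviation bounds; the remaining term [ln M]
   pays for the union over the net. *)
have CE : C = ln delta^-1 + ln (delta / M)^-1.
  rewrite /C /C_log invf_div -exprVn lnXn ?invr_gt0// lnM ?posrE ?invr_gt0//.
  rewrite /M lnXn ?addr_gt0 ?mulr_gt0// -[ln (1 + _) *+ p]mulr_natl mulr2n.
  by rewrite [RHS]addrCA addrC -!addrA addrC -!addrA.
have C0 : 0 < C.
  have ld : 0 < ln delta^-1.
    by rewrite ln_gt0// invf_gt1//; lra.
  rewrite CE addr_gt0// invf_div lnM ?posrE ?invr_gt0// ltr_wpDl// ln_ge0//.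
have [alpha0 alphaE CnE SE] := alpha_scale_facts beta_gt1 Rl0 C0 n_gt0.
rewrite -/alpha in alpha0 alphaE CnE SE.
set S := alpha `^ (beta - 1) in alphaE CnE SE.
have S0 : 0 <= S by exact: powR_ge0.
have [N [x [NM xT xnet]]] := exists_net r_gt0 n_gt0 Theta_bounded.
(* Half of [l_tau] times the net radius 2/n. *)
pose s := l_lip tau / n%:R.
have s0 : 0 <= s by rewrite divr_ge0 ?(ltW l0)// ltW.
have ls (t : R) : t <= 2 / n%:R -> l_lip tau / 2 * t <= s.
  move=> tn; rewrite (_ : s = l_lip tau / 2 * (2 / n%:R)); last first.
    by rewrite /s; field; rewrite gt_eqF.
  by rewrite ler_wpM2l// divr_ge0 ?(ltW l0).
(* The exponents of the two moment bounds, in the role of [c] in [iid_chernoff]: [c1] at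
   [theta_star], [c2 j] at the net point [x j]. *)
pose c1 := alpha * risk theta_star + alpha `^ beta * Rl.
pose c2 j := alpha * s * EX - alpha * risk (x j) +
  alpha `^ beta * 2 `^ (beta - 1) * (Rl + s `^ beta / beta * EXbeta).
pose h1 z := psi (alpha * loss tau theta_star z).
pose h2 j (z : Rvec R p * R) := - psi (alpha * (loss tau (x j) z - s * norm2 z.1)).
have mpsi := measurable_truncation psi_trunc.
have mh1 : measurable_fun setT h1.
  apply: (measurableT_comp mpsi); apply: measurable_funM => //.
  exact: measurable_loss.
have mh2 j : measurable_fun setT (h2 j).
  apply: measurable_funN; apply: (measurableT_comp mpsi).
  apply: measurable_funM => //; apply: measurable_funB; first exact: measurable_loss.
  by apply: measurable_funM => //; exact: measurable_norm2_fst.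
have [mB1 PB1] := iid_chernoff delta_gt0 sample_iid mZs mZ mh1
  (exp_truncated_loss_le mZ beta_gt1 psi_trunc alpha0 (LRl _ Tstar)).
(* Each of the at most [M] net points is allowed failure probability delta/M. *)
have dM0 : 0 < delta / M by rewrite divr_gt0.
have bad2 j := iid_chernoff dM0 sample_iid mZs mZ (mh2 j)
  (exp_truncated_lossN_le mZ iX beta_gt1 psi_trunc iXb alpha0 s0 (LRl _ (xT j))).
have [mB2 PB2] := union_bound bad2.
set B1 := [set w | _] in mB1 PB1.
set B2 := \bigcup_i _ in mB2 PB2.
have PB : (P (B1 `|` B2) <= (2 * delta)%:E)%E.
  apply: (le_trans (measureU2 _ mB1 mB2)).
  rewrite (le_trans (leeD PB1 PB2))// -EFinD lee_fin.
  rewrite (_ : 2 * delta = delta + delta); last by ring.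
  rewrite lerD2l mulrCA ler_piMr ?(ltW delta_gt0)// ler_pdivrMr// mul1r.
  exact: NM.
pose bound := 2 * l_lip tau * EX / n%:R
  + C_risk beta tau Rl EXbeta * (C / n%:R) `^ ((beta - 1) / beta)
  + rho * norm2 theta_star ^+ 2.
set E := [set w | _].
(* Monotonicity of [P] requires a measurable event; the goal is then that [E] contains the
   complement of the bad events. *)
have mE : measurable E.
  have mr : measurable_fun [set: T] (fun w => risk (theta_hat w)).
    have mrisk := measurable_rrisk mZ tau01 iX (il _ Tstar).
    exact: (measurableT_comp mrisk (@measurable_funPT _ _ _ _ theta_hat)).
  have := mr measurableT _ (@measurable_itv R `]-oo, (bound + risk theta_star)]).
  rewrite setTI; congr measurable; apply/seteqP; split=> w /=;
    rewrite /E/= !riskE//; try exact: (theta_hat_min w).1;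
    by rewrite in_itv/= -EFinB lee_fin lerBlDr.
apply: (@le_trans _ _ (P (~` (B1 `|` B2)))).
  rewrite probability_setC ?EFinB; last exact: measurableU.
  by rewrite leeB.
apply: le_measure; rewrite ?inE//; first by apply: measurableC; exact: measurableU.
move=> w; rewrite setCU => -[G1 G2].
have [That Targ] := theta_hat_min w.
have [j nj] := xnet _ That.
have {}G1 : \sum_(i < n) h1 (Zs i w) <= n%:R * c1 + ln delta^-1.
  by rewrite leNgt; apply/negP => H; apply: G1; exact: ltW.
have {}G2 : \sum_(i < n) h2 j (Zs i w) <= n%:R * c2 j + ln (delta / M)^-1.
  rewrite leNgt; apply/negP => H; apply: G2; exists j => //=.
  by rewrite -EXE -EXbE; exact: ltW.
(* The net point's loss minus s|X| is at most the loss at [theta_hat], and [psi] is monotone. *)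
have key1 : - (\sum_(i < n) h2 j (Zs i w)) <=
    \sum_(i < n) psi (alpha * loss tau (theta_hat w) (Zs i w)).
  rewrite -sumrN; apply: ler_sum => i _; rewrite opprK; apply: psi_trunc.1.
  rewrite ler_pM2l// lerBlDr (le_trans (loss_le tau01 (x j) (theta_hat w) _))//.
  rewrite lerD2l [norm2 (Zs i w).1 * _]mulrC mulrA ler_wpM2r ?norm2_ge0//.
  by apply: ls; rewrite norm2B.
have key2 : risk (theta_hat w) <= risk (x j) + s * EX.
  apply: (le_trans (rrisk_le mZ tau01 iX (theta_hat w) (il _ (xT j)))).
  by rewrite lerD2l -EXE ler_wpM2r// ls.
(* Since n >= 1, [s] is at most [l_tau]; this yields the n-free constant in [C_risk]. *)
have sb : s `^ beta <= l_lip tau `^ beta.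
  apply: ge0_ler_powR; rewrite ?nnegrE ?(ltW b0) ?(ltW l0)//.
  by rewrite ler_pdivrMr// ler_peMr ?(ltW l0)// ler1n.
have := Targ _ Tstar; rewrite /truncated_objective.
rewrite /E/= !riskE// -EFinB lee_fin.
set Sh := \sum_(i < n) psi (alpha * check_loss tau (_ - dotv _ (theta_hat w))).
set Ss := \sum_(i < n) psi (alpha * check_loss tau (_ - dotv _ theta_star)).
rewrite -/Ss in G1 *; rewrite -/Sh in key1.
have rho0 : 0 <= rho * norm2 (theta_hat w) ^+ 2 by rewrite mulr_ge0// sqr_ge0.
have hn : 0 < n%:R * alpha by rewrite mulr_gt0.
set I := 1 / (n%:R * alpha) => Hobj.
have hI : 0 <= I by rewrite divr_ge0// ltW.
set K := (2 `^ (beta - 1) + 1) * Rl in CnE SE.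
have nI : I * n%:R * alpha = 1 by rewrite -mulrA /I div1r mulVf// gt_eqF.
(* The balance of [alpha]: the deviation terms add up to S K, the same amount as the two terms in
   [Rl] of [J1] and [J2], whence the 2K in the bound. *)
have E3 : I * C = S * K by rewrite /I div1r mulrC CnE.
have J1 : I * Ss <= I * n%:R * alpha * (risk theta_star + S * Rl) + I * ln delta^-1.
  have := ler_wpM2l hI G1; rewrite /c1 alphaE; lra.
have J2 : - (I * Sh) <= I * n%:R * alpha * (s * EX - risk (x j) +
    S * 2 `^ (beta - 1) * (Rl + s `^ beta / beta * EXbeta)) + I * ln (delta / M)^-1.
  have H : - Sh <= n%:R * c2 j + ln (delta / M)^-1 by rewrite (le_trans _ G2)// lerNl.
  have := ler_wpM2l hI H; rewrite /c2 alphaE; lra.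
have J3 : S * 2 `^ (beta - 1) * (s `^ beta / beta * EXbeta) <=
    S * 2 `^ (beta - 1) * (l_lip tau `^ beta / beta * EXbeta).
  rewrite ler_wpM2l ?mulr_ge0 ?powR_ge0// ler_wpM2r// ler_wpM2r//.
  by rewrite invr_ge0 ltW.
have -> : C_risk beta tau Rl EXbeta * (C / n%:R) `^ ((beta - 1) / beta) =
    S * (2 * K + 2 `^ (beta - 1) * l_lip tau `^ beta / beta * EXbeta).
  rewrite SE /C_risk -/K; set D := (K `^ _)^-1; set ib := beta^-1.
  by rewrite /K; ring.
rewrite nI !mul1r in J1 J2; rewrite CE mulrDr in E3.
have -> : 2 * l_lip tau * EX / n%:R = 2 * (s * EX) by rewrite /s; ring.
(* Chain: risk at [theta_hat] to the net point ([key2]), to the empirical value ([J2]), to that at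
   [theta_star] by minimality ([Hobj]), to its risk ([J1]). The penalty at [theta_hat] is dropped by
   [rho0]. *)
move: Hobj J1 J2 J3 E3 key2; rewrite /K.
lra.
Qed.
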